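(* Let $K$ be a field, $S=K[x_1,\ldots,x_n]$, and let $I\subset S$ be a monomial ideal with $\dim S/I=0$. Let $L(I)\subset S^\wp$ be the ideal generated by the monomials $x_{1,a_1+1}\cdots x_{n,a_n+1}$ with $x_1^{a_1}\cdots x_n^{a_n}\in\operatorname{Mon}(S\setminus I)$. Then $L(I)$ has linear quotients.
   Context: $\operatorname{Mon}(S\setminus I)$ is the (finite) set of monomials of $S$ not belonging to $I$. For $i=1,\ldots,n$ let $b_i\ge 1$ be the smallest integer with $x_i^{b_i}\in I$ (it exists since $\dim S/I=0$). $S^\wp$ is the polynomial ring over $K$ in the variables $x_{i,j}$, $1\le i\le n$, $1\le j\le b_i$. A monomial ideal $J$ has linear quotients if its minimal monomial generators can be ordered $u_1,\ldots,u_m$ so that for each $j=2,\ldots,m$ the colon ideal $(u_1,\ldots,u_{j-1}):u_j$ is generated by a set of variables. *)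

(* Defs.v *)
From HB Require Import structures.
From mathcomp Require Import all_boot all_order all_algebra.
From mathcomp Require Import ring_quotient mpoly.
From Stdlib Require Import ClassicalEpsilon.

Set Implicit Arguments.
Unset Strict Implicit.
Unset Printing Implicit Defensive.

Import Order.TTheory GRing.Theory.
Local Open Scope ring_scope.

Section Ideals.
Variable R : comNzRingType.

(* The library ideals [idealr R] are proper by definition; the ideals that are
   generated by sets or obtained as colons below may be improper, so they are
   plain predicates on the ring. *)
Definition ideal_gen (A : R -> Prop) (p : R) : Prop :=
  exists2 s : seq (R * R), (forall c, c \in s -> A c.2)
                         & p = \sum_(c <- s) c.1 * c.2.

Definition colon (J : R -> Prop) (f p : R) : Prop := J (p * f).

Definition same_ideal (I J : R -> Prop) : Prop := forall p, I p <-> J p.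

(* P 0, ..., P l is a strictly increasing chain of prime ideals (of length l);
   the values of P beyond l are irrelevant. *)
Definition prime_chain (l : nat) (P : nat -> prime_idealr R) : Prop :=
  forall i, (i < l)%N ->
    {subset P i <= P i.+1} /\ ~ {subset P i.+1 <= P i}.

Definition has_krull_dim (d : nat) : Prop :=
  (exists P, prime_chain d P) /\ (forall l P, prime_chain l P -> (l <= d)%N).

End Ideals.

Section MonomialIdeals.
Variables (K : fieldType) (n : nat).
Implicit Type J : {mpoly K[n]} -> Prop.

Definition monomial_gen (G : 'X_{1..n} -> Prop) : {mpoly K[n]} -> Prop :=
  ideal_gen (fun p => exists2 m, G m & p = 'X_[m]).

Definition is_monomial_ideal J : Prop :=
  exists G : 'X_{1..n} -> Prop, same_ideal J (monomial_gen G).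

Definition mgens (us : seq 'X_{1..n}) : {mpoly K[n]} -> Prop :=
  monomial_gen (fun m => m \in us).

Definition minimal_monomial_generators J (us : seq 'X_{1..n}) : Prop :=
  same_ideal J (mgens us) /\
  forall vs : seq 'X_{1..n}, {subset vs <= us} ->
    same_ideal J (mgens vs) -> {subset us <= vs}.

Definition generated_by_variables J : Prop :=
  exists V : {set 'I_n},
    same_ideal J (ideal_gen (fun p => exists2 i, i \in V & p = 'X_i)).

(* With zero-based positions, u_j for j = 2, ..., m is the entry at position
   j = 1, ..., m - 1, and [take j us] lists the generators before it. *)
Definition has_linear_quotients J : Prop :=
  exists us : seq 'X_{1..n},
    [/\ uniq us, minimal_monomial_generators J us
      & forall j, (0 < j < size us)%N ->
          generated_by_variables
            (colon (mgens (take j us)) 'X_[nth 0%MM us j])].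

End MonomialIdeals.

Section Polarization.
Variables (K : fieldType) (n : nat) (I : idealr {mpoly K[n]}).

Definition Mon_compl (a : 'X_{1..n}) : Prop := ('X_[a] : {mpoly K[n]}) \notin I.

(* The least k with x_i^k in I; the value 0 is only taken when no power of x_i
   lies in I, because I is proper. *)
Definition var_exponent (i : 'I_n) : nat :=
  match excluded_middle_informative
          (exists k, ('X_i ^+ k : {mpoly K[n]}) \in I) with
  | left ex_k => ex_minn ex_k
  | right _ => 0%N
  end.

(* Indices of the variables x_{i,j}, with the second index shifted to start
   at 0: the pair of i and j : 'I_(var_exponent i) stands for x_{i,j+1}. *)
Definition pol_index : finType := {i : 'I_n & 'I_(var_exponent i)}.

Definition pol_var (i : 'I_n) (j : 'I_(var_exponent i)) :
    {mpoly K[#|pol_index|]} :=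
  'X_(enum_rank (Tagged (fun i => 'I_(var_exponent i)) j : pol_index)).

(* If x^a is not in I then a i < var_exponent i holds for every i at which some
   power of x_i is in I, so in the zero-dimensional case the requirement
   [lt_ab] excludes no a. *)
Definition L_ideal : {mpoly K[#|pol_index|]} -> Prop :=
  ideal_gen (fun p =>
    exists (a : 'X_{1..n}) (lt_ab : forall i, (a i < var_exponent i)%N),
      Mon_compl a /\ p = \prod_(i < n) pol_var (Ordinal (lt_ab i))).

End Polarization.

Arguments L_ideal {K n} I.

(* Main.v *)
(** Identify [Mon(S \ I)] with a set of functions [f] satisfying
    [f i < var_exponent i]; it is closed under taking smaller functions. Order
    the generators [u_f] by any linear extension of the componentwise order,
    for instance by total degree. If [f] precedes [g], then [f i < g i] for
    some [i], and the function [h] obtained from [g] by changing its value at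
    [i] to [f i] again precedes [g]; as [u_h] and [u_g] differ in the single
    factor indexed by [i], the variable [x_(i, f i)] lies in the colon ideal at
    [g], and it divides [u_f / gcd(u_f, u_g)]. *)

Require Import Defs.
From mathcomp Require Import all_boot all_order all_algebra.
From mathcomp Require Import ring_quotient mpoly.

Set Implicit Arguments.
Unset Strict Implicit.
Unset Printing Implicit Defensive.

Import Order.TTheory GRing.Theory.
Local Open Scope ring_scope.

Lemma ideal_gen_ext (R : comNzRingType) (A B : R -> Prop) :
  (forall p, A p <-> B p) -> same_ideal (ideal_gen A) (ideal_gen B).
Proof. by move=> AB p; split=> -[s sP ->]; exists s => // c /sP /AB. Qed.

Lemma ideal_gen0 (R : comNzRingType) (A : R -> Prop) : ideal_gen A 0.
Proof. by exists [::]; rewrite ?big_nil. Qed.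

Lemma ideal_genD (R : comNzRingType) (A : R -> Prop) (p q : R) :
  ideal_gen A p -> ideal_gen A q -> ideal_gen A (p + q).
Proof.
move=> [s sA ->] [t tA ->]; exists (s ++ t); last by rewrite big_cat.
by move=> c; rewrite mem_cat => /orP[/sA|/tA].
Qed.

Lemma ideal_genMl (R : comNzRingType) (A : R -> Prop) (p q : R) :
  A q -> ideal_gen A (p * q).
Proof.
by move=> Aq; exists [:: (p, q)]; [move=> c /[1!inE] /eqP-> | rewrite big_seq1].
Qed.

(** Multiplying by a monomial shifts the support, and conversely [p] is the sum of its terms. Hence
    ideal membership becomes divisibility of exponents. *)
Lemma monomial_genP (K : fieldType) (n : nat) (G : 'X_{1..n} -> Prop)
    (p : {mpoly K[n]}) :
  monomial_gen G p <->
  forall m, m \in msupp p -> exists2 g, G g & (g <= m)%MM.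
Proof.
split=> [[s sG ->] | pG].
  elim: s sG => [|c s IHs] sG m; first by rewrite big_nil msupp0.
  rewrite big_cons => /msuppD_le; rewrite mem_cat => /orP[|]; last first.
    by apply: IHs => d ds; apply: sG; rewrite inE ds orbT.
  have [g Gg ->] := sG c (mem_head _ _).
  rewrite (perm_mem (msuppMX _ _)) => /mapP[m' _ ->].
  by exists g => //; apply: lem_addr.
rewrite (mpolyE p) big_seq; apply: big_ind => [|q r|m /pG[g Gg le_gm]].
- exact: ideal_gen0.
- exact: ideal_genD.
- rewrite -(submK le_gm) mpolyXD scalerAl.
  by apply: ideal_genMl; exists g.
Qed.

Lemma minimal_monomial_generators_antichain (K : fieldType) (n : nat)
    (us : seq 'X_{1..n}) :
  {in us &, forall u v, (u <= v)%MM -> u = v} ->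
  @minimal_monomial_generators K n (mgens us) us.
Proof.
move=> anti; split=> // vs vs_us gen_vs u us_u.
have /gen_vs/monomial_genP/(_ u) : @mgens K n us 'X_[u].
  by apply/monomial_genP => m; rewrite msuppX inE => /eqP->; exists u; rewrite ?lepm_refl.
rewrite msuppX inE eqxx => /(_ isT)[v vs_v le_vu].
by rewrite -(anti v u (vs_us v vs_v) us_u le_vu).
Qed.

(** The exponent of [u_f]. The dependent type of [f] builds in the bounds [e], so the candidates
    form a finite type that can be enumerated and sorted. *)
Definition polar_mnm (n : nat) (e : 'I_n -> nat)
    (f : {dffun forall i, 'I_(e i)}) : 'X_{1..#|{: {i : 'I_n & 'I_(e i)}}|} :=
  (\sum_(i < n) U_(enum_rank (Tagged (fun i => 'I_(e i)) (f i))))%MM.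

Lemma polar_mnmE (n : nat) (e : 'I_n -> nat) (f : {dffun forall i, 'I_(e i)})
    (i : 'I_n) (j : 'I_(e i)) :
  polar_mnm f (enum_rank (Tagged (fun i => 'I_(e i)) j)) = (f i == j).
Proof.
rewrite mnm_sumE (bigD1 i) //= mnm1E (inj_eq enum_rank_inj) eq_Tagged /=.
rewrite big1 ?addn0 // => k neq_ki.
rewrite mnm1E (inj_eq enum_rank_inj) -tag_eqE /tag_eq /=.
by rewrite (negPf neq_ki).
Qed.

(** Comparing exponents at the variable of [(i, f i)] forces [g i = f i]. This yields both
    injectivity of [f |-> u_f] and minimality of the generators. *)
Lemma polar_mnm_le (n : nat) (e : 'I_n -> nat)
    (f g : {dffun forall i, 'I_(e i)}) :
  (polar_mnm f <= polar_mnm g)%MM -> f = g.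
Proof.
move/mnm_lepP => le_fg; apply/ffunP => i.
have := le_fg (enum_rank (Tagged (fun i => 'I_(e i)) (f i))).
by rewrite !polar_mnmE eqxx; case: eqP.
Qed.

Lemma polar_mnm_replace (n : nat) (e : 'I_n -> nat)
    (g h : {dffun forall i, 'I_(e i)}) (i : 'I_n) :
  (forall k, k != i -> h k = g k) ->
  (polar_mnm h <=
     U_(enum_rank (Tagged (fun i => 'I_(e i)) (h i))) + polar_mnm g)%MM.
Proof.
move=> hg; apply/mnm_lepP => v; rewrite -(enum_valK v).
case: (enum_val v) => k j; rewrite mnmDE !polar_mnmE mnm1E.
have [eq_ki|/hg->] := eqVneq k i; last exact: leq_addl.
by subst k; rewrite (inj_eq enum_rank_inj) eq_Tagged /= leq_addr.
Qed.

(** Here [s] stands for the generators preceding [g]. The first hypothesis bounds the colon ideal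
    from above, the second puts each variable [(i, j)] with [j < g i] into it. *)
Lemma polar_colon_generated_by_variables (K : fieldType) (n : nat)
    (e : 'I_n -> nat) (s : seq {dffun forall i, 'I_(e i)})
    (g : {dffun forall i, 'I_(e i)}) :
  (forall f, f \in s -> exists i, (f i < g i)%N) ->
  (forall h : {dffun forall i, 'I_(e i)},
     (forall i, (h i <= g i)%N) -> h != g -> h \in s) ->
  generated_by_variables
    (@colon {mpoly K[_]} (mgens [seq polar_mnm f | f <- s]) 'X_[polar_mnm g]).
Proof.
move=> s_lt s_below.
pose V := [set enum_rank t | t : {i : 'I_n & 'I_(e i)}
                           & (tagged t < g (tag t))%N].
exists V => p.
have gensV : same_ideal (ideal_gen (fun q => exists2 v, v \in V & q = 'X_v))
    (@monomial_gen K _ (fun m => exists2 v, v \in V & m = U_(v)%MM)).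
  apply: ideal_gen_ext => q; split=> [[v Vv ->]|[_ [v Vv ->] ->]].
    by exists U_(v)%MM => //; exists v.
  by exists v.
split=> [/monomial_genP pG | /gensV/monomial_genP pV].
  apply/gensV/monomial_genP => m p_m.
  have [|_ /mapP[f sf ->] /mnm_lepP le_f] := pG (polar_mnm g + m)%MM.
    by rewrite (perm_mem (msuppMX _ _)) map_f.
  have [i lt_fg] := s_lt f sf.
  set v := enum_rank (Tagged (fun i => 'I_(e i)) (f i)).
  exists U_(v)%MM; first by exists v => //; apply: imset_f; rewrite inE.
  apply/mnm_lepP => w; rewrite mnm1E; have [<-|//] := eqVneq.
  (* At [v] the exponent of [u_f] is 1 and that of [u_g] is 0, since [f i < g i]; so [m] must
     contain [v]. *)
  have := le_f v; rewrite mnmDE !polar_mnmE eqxx.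
  by rewrite -val_eqE /= gtn_eqF.
apply/monomial_genP => m; rewrite (perm_mem (msuppMX _ _)).
case/mapP=> {}m /pV[_ [_ /imsetP[[i j] + ->] ->] le_vm] ->.
rewrite inE /= => lt_jg.
(* [h] is [g] lowered to [j] at [i]. Passing through natural numbers avoids a cast from ['I_(e i)]
   to ['I_(e k)]; the default of [insubd] is never taken. *)
pose h : {dffun forall i, 'I_(e i)} :=
  [ffun k => insubd (g k) (if k == i then val j else val (g k))].
have hi : h i = j by apply: val_inj; rewrite ffunE eqxx val_insubd ltn_ord.
have hg k : k != i -> h k = g k.
  move=> /negPf neq_ki; apply: val_inj.
  by rewrite ffunE neq_ki val_insubd ltn_ord.
exists (polar_mnm h).
  apply/map_f/s_below => [k|].
    by have [->|/hg->//] := eqVneq k i; rewrite hi ltnW.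
  by apply: contraTneq lt_jg => <-; rewrite hi ltnn.
apply: lepm_trans (polar_mnm_replace hg) _.
rewrite hi addmC; apply/mnm_lepP => w.
by rewrite !mnmDE leq_add2l; move/mnm_lepP: le_vm.
Qed.

Lemma polar_linear_quotients (K : fieldType) (n : nat) (e : 'I_n -> nat)
    (D : pred {dffun forall i, 'I_(e i)}) :
  (forall f g : {dffun forall i, 'I_(e i)},
     (forall i, (f i <= g i)%N) -> D g -> D f) ->
  has_linear_quotients (@monomial_gen K _
    (fun m => exists2 f, D f & m = polar_mnm f)).
Proof.
move=> D_down.
(* Total degree is strictly monotone for the componentwise order, so sorting by it gives a linear
   extension however ties are broken. *)
pose wt (f : {dffun forall i, 'I_(e i)}) := (\sum_(i < n) f i)%N.
pose s := sort (relpre wt leq) (enum D).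
have mem_s f : (f \in s) = D f by rewrite mem_sort mem_enum.
have wt_trans : transitive (relpre wt leq) by move=> ? ? ?; apply: leq_trans.
have s_sorted : sorted (relpre wt leq) s.
  by apply: sort_sorted => f g; apply: leq_total.
have s_uniq : uniq s by rewrite sort_uniq enum_uniq.
have wt_le (f g : {dffun forall i, 'I_(e i)}) :
     (forall i, (f i <= g i)%N) -> f != g -> (wt f < wt g)%N.
  move=> le_fg neq_fg; rewrite ltn_neqAle leq_sum // andbT.
  apply: contra_neq neq_fg => eq_wt; apply/ffunP => i; apply: val_inj.
  apply/eqP; move/eqP: eq_wt.
  by rewrite (leqif_sum (fun i _ => leqif_eq (le_fg i))) => /forallP/(_ i).
have gens : same_ideal
    (@monomial_gen K _ (fun m => exists2 f, D f & m = polar_mnm f))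
    (mgens (map (@polar_mnm n e) s)).
  apply: ideal_gen_ext => p; split=> [[_ [f Df ->] ->]|[_ /mapP[f sf ->] ->]].
    by exists (polar_mnm f) => //; rewrite map_f ?mem_s.
  by exists (polar_mnm f) => //; exists f; rewrite -?mem_s.
exists (map (@polar_mnm n e) s); split.
- rewrite map_inj_uniq // => f g eq_fg.
  by apply: polar_mnm_le; rewrite eq_fg lepm_refl.
- have [] := @minimal_monomial_generators_antichain K _ (map (@polar_mnm n e) s).
    by move=> _ _ /mapP[f _ ->] /mapP[g _ ->] /polar_mnm_le->.
  move=> _ min_s; split=> // vs vs_s gen_vs; apply: min_s => // p.
  by rewrite -gens.
move=> j; rewrite size_map => /andP[_ lt_js].
have [f0 _] : exists f0, f0 \in s.
  by case: (s) lt_js => // f0 ? _; exists f0; rewrite mem_head.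
rewrite -map_take (nth_map f0) //.
set g := nth f0 s j.
have sg : g \in s by apply: mem_nth.
have idx_g : index g s = j by apply: index_uniq.
have in_take f : (f \in take j s) = (f \in s) && (index f s < j)%N.
  rewrite in_take_leq ?(ltnW lt_js) // -index_mem andbC.
  by case: ltnP => // lt_fj; rewrite (ltn_trans lt_fj).
apply: polar_colon_generated_by_variables => [f|h le_hg neq_hg].
  rewrite in_take => /andP[sf lt_fj].
  (* If no such [i] exists, then [g <= f] componentwise, so [g = f] or [wt g < wt f]; in neither
     case can [f] precede [g]. *)
  apply/existsP; apply: contraTT lt_fj => /existsPn ge_fg.
  rewrite -leqNgt -idx_g.
  have [->//|neq_gf] := eqVneq g f.
  rewrite leqNgt; apply/negP => lt_fg.
  have := sorted_ltn_index wt_trans s_sorted f g sf sg lt_fg.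
  by rewrite /= leqNgt wt_le // => i; rewrite leqNgt ge_fg.
have sh : h \in s by rewrite mem_s (D_down _ _ le_hg) -?mem_s.
rewrite in_take sh /= ltnNge -idx_g.
apply: contraL (wt_le _ _ le_hg neq_hg) => le_gh; rewrite -leqNgt.
have wt_refl : reflexive (relpre wt leq) by move=> ?; apply: leqnn.
by have := sorted_leq_index wt_trans wt_refl s_sorted g h sg sh; apply.
Qed.

Theorem theorem2p1 (K : fieldType) (n : nat) (I : idealr {mpoly K[n]})
    (monI : is_monomial_ideal (fun p => p \in I))
    (dimI : has_krull_dim {ideal_quot I} 0) :
  has_linear_quotients (L_ideal I).
Proof.
pose e := var_exponent I.
pose expo (f : {dffun forall i, 'I_(e i)}) := [multinom f i : nat | i < n].
pose D f := ('X_[expo f] : {mpoly K[n]}) \notin I.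
(* If [x^f] were in [I], so would be its multiple [x^g]. *)
have D_down (f g : {dffun forall i, 'I_(e i)}) :
     (forall i, (f i <= g i)%N) -> D g -> D f.
  move=> le_fg; apply: contra => If.
  have /submK<- : (expo f <= expo g)%MM by apply/mnm_lepP => i; rewrite !mnmE.
  by rewrite mpolyXD idealMr.
have [us [us_uniq [us_gen us_min] us_lin]] :=
  @polar_linear_quotients K _ _ D D_down.
have gens : same_ideal (L_ideal I) (@monomial_gen K _
    (fun m => exists2 f, D f & m = polar_mnm f)).
  apply: ideal_gen_ext => p; split=> [[a [lt_ae [Ia ->]]] | [_ [f Df ->] ->]].
    pose f : {dffun forall i, 'I_(e i)} := [ffun i => Ordinal (lt_ae i)].
    exists (polar_mnm f).
      exists f => //; congr (_ \notin I): Ia; congr 'X_[_].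
      by apply/mnmP => i; rewrite mnmE ffunE.
    by rewrite /polar_mnm -mprodXE; apply: eq_bigr => i _; rewrite ffunE.
  have lt_fe i : (expo f i < e i)%N by rewrite mnmE.
  exists (expo f), lt_fe; split=> //.
  rewrite /polar_mnm -mprodXE; apply: eq_bigr => i _.
  by congr (pol_var _); apply: val_inj; rewrite /= mnmE.
(* The colon condition mentions only the list [us]; just the generation and minimality clauses must
   be carried over to [L_ideal I]. *)
exists us; split=> //; split=> [p|vs vs_us gen_vs].
  by rewrite gens.
by apply: us_min => // p; rewrite -gens.
Qed.
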